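(* Let $R$ be a Mori domain which is not a field, and let $\bar R$ be its complete integral closure. If $R$ is an FC-domain, then $\bar R$ is a semilocal Dedekind domain and $(R:\bar R)\neq (0)$; in particular $\dim_v R=1$. Moreover, if (in addition) $A=(R:\bar R)$ is a finitely generated ideal of $R$, then $R$ is Noetherian.
   Context: Let $L$ be the quotient field of $R$. An overring of $R$ is a ring $T$ with $R\subseteq T\subseteq L$; $R$ is an FC-domain if each chain of distinct overrings of $R$ is finite. For a nonzero fractional ideal $I$ of $R$, $I^{-1}=(R:I)=\{x\in L: xI\subseteq R\}$ and $I_v=(I^{-1})^{-1}$; $I$ is a $v$-ideal (divisorial) if $I=I_v$. $R$ is a Mori domain if it satisfies the ascending chain condition on $v$-ideals contained in $R$. The complete integral closure $\bar R$ is the set of $x\in L$ for which there is a nonzero $d\in R$ with $dx^n\in R$ for all $n\ge 1$. For an overring $T$, $(R:T)=\{x\in L: xT\subseteq R\}$. The valuative dimension is $\dim_v R=\max\{\dim V : V \text{ a valuation overring of } R\}$. A semilocal domain is a domain with finitely many maximal ideals (not assumed Noetherian). *)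

(* Defs.v *)
From HB Require Import structures.
From mathcomp Require Import all_boot all_order all_algebra.
From mathcomp Require Import boolp classical_sets functions cardinality.

Set Implicit Arguments.
Unset Strict Implicit.
Unset Printing Implicit Defensive.

Import GRing.Theory.

Local Open Scope classical_set_scope.
Local Open Scope ring_scope.

(* All the rings considered are subrings of a fixed field [L], given by their
   underlying sets; ideals and fractional ideals are subsets of [L] as well.  In the
   notions relative to a base ring [R] (overrings, [colon], divisorial ideals,
   complete integral closure, valuative dimension), [L] is meant to be the
   quotient field of [R]. *)

Definition subring (L : fieldType) (T : set L) : Prop :=
  subring_closed [in T].

Definition domain_with_quotient_field (L : fieldType) (R : set L) : Prop :=
  subring R /\ forall x : L, exists a b, [/\ R a, R b, b != 0 & x = a / b].

Definition is_field (L : fieldType) (T : set L) : Prop :=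
  subring T /\ forall x, T x -> x != 0 -> T x^-1.

Definition overring (L : fieldType) (R T : set L) : Prop :=
  subring T /\ R `<=` T.

Definition FC_domain (L : fieldType) (R : set L) : Prop :=
  forall C : set (set L),
    C `<=` overring R -> total_on C subset -> finite_set C.

Definition submodule (L : fieldType) (T M : set L) : Prop :=
  [/\ M 0, (forall x y, M x -> M y -> M (x + y)) &
      (forall a x, T a -> M x -> M (a * x))].

Definition ideal (L : fieldType) (T I : set L) : Prop :=
  submodule T I /\ I `<=` T.

Definition prime_ideal (L : fieldType) (T P : set L) : Prop :=
  [/\ ideal T P, ~ P 1 &
      forall x y, T x -> T y -> P (x * y) -> P x \/ P y].

Definition maximal_ideal (L : fieldType) (T M : set L) : Prop :=
  [/\ ideal T M, M <> T &
      forall J, ideal T J -> M `<=` J -> J = M \/ J = T].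

Definition semilocal (L : fieldType) (T : set L) : Prop :=
  finite_set (maximal_ideal T).

Definition finitely_generated (L : fieldType) (T I : set L) : Prop :=
  exists (n : nat) (g : 'I_n -> L),
    I = [set x | exists2 c : 'I_n -> L,
                   forall i, T (c i) & x = \sum_(i < n) c i * g i].

Definition noetherian (L : fieldType) (T : set L) : Prop :=
  forall I, ideal T I -> finitely_generated T I.

Definition colon (L : fieldType) (R M : set L) : set L :=
  [set x | forall y, M y -> R (x * y)].

Definition nonzero_fractional_ideal (L : fieldType) (R I : set L) : Prop :=
  [/\ submodule R I, I <> [set 0] &
      exists d, [/\ R d, d != 0 & forall x, I x -> R (d * x)]].

Definition v_closure (L : fieldType) (R I : set L) : set L :=
  colon R (colon R I).

Definition v_ideal (L : fieldType) (R I : set L) : Prop :=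
  nonzero_fractional_ideal R I /\ I = v_closure R I.

Definition mori (L : fieldType) (R : set L) : Prop :=
  forall I : nat -> set L,
    (forall n, v_ideal R (I n) /\ I n `<=` R) ->
    (forall n, I n `<=` I n.+1) ->
    exists N, forall n, (N <= n)%N -> I n = I N.

Definition complete_integral_closure (L : fieldType) (R : set L) : set L :=
  [set x | exists d, [/\ R d, d != 0 &
                         forall n, (1 <= n)%N -> R (d * x ^+ n)]].

Definition integral_over (L : fieldType) (T : set L) (x : L) : Prop :=
  exists p : {poly L}, [/\ p \is monic, p \is a polyOver [in T] & root p x].

(* The quotient field of [T] is realised as the set of fractions in [L]. *)
Definition integrally_closed (L : fieldType) (T : set L) : Prop :=
  forall a b, T a -> T b -> b != 0 -> integral_over T (a / b) -> T (a / b).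

(* Fields are not counted as Dedekind domains. *)
Definition dedekind (L : fieldType) (T : set L) : Prop :=
  [/\ subring T, ~ is_field T, noetherian T, integrally_closed T &
      forall P, prime_ideal T P -> P <> [set 0] -> maximal_ideal T P].

Definition prime_chain (L : fieldType) (T : set L) (n : nat)
    (P : nat -> set L) : Prop :=
  (forall i, (i <= n)%N -> prime_ideal T (P i)) /\
  (forall i, (i < n)%N -> P i `<` P i.+1).

Definition has_krull_dim (L : fieldType) (T : set L) (n : nat) : Prop :=
  (exists P, prime_chain T n P) /\
  (forall m P, prime_chain T m P -> (m <= n)%N).

Definition valuation_overring (L : fieldType) (R V : set L) : Prop :=
  overring R V /\ forall x, x != 0 -> V x \/ V x^-1.

Definition has_valuative_dim (L : fieldType) (R : set L) (n : nat) : Prop :=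
  (exists2 V, valuation_overring R V & has_krull_dim V n) /\
  (forall V, valuation_overring R V ->
     exists2 m, has_krull_dim V m & (m <= n)%N).

(* Main.v *)
(* FC yields a largest overring with nonzero conductor, and this overring is the
   complete integral closure T; it is completely integrally closed.  The chain
   R[u] >= R[u^2] >= R[u^4] >= ... makes every u in L a root of a polynomial over
   R with a coefficient 1; since T is completely integrally closed, this yields
   the invertibility of the fractional ideal (1, u), so T is Pruefer.  For J
   invertible over T and a in (R : T), the set a J is a divisorial ideal of R, so
   the Mori property gives the ascending chain condition on invertible ideals
   of T, hence every nonzero ideal of T is finitely generated and invertible, and
   T is Dedekind.

   For the valuative dimension, every valuation overring V of R must be shown to
   contain T.  Given x in T outside V, the Mori property produces almost inverses
   in R (r^N (r q - 1) in a T with q in R) which force r x^m in V for all m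
   and every r in R that is a nonunit of V; this contradicts the polynomial
   equation of x having a coefficient 1.

   If (R : T) is finitely generated then so is T over R.  The almost inverses make
   R / (M \cap R) a field for each maximal ideal M of T, so each step of a
   composition series of T over an ideal i (R : T), i <> 0, preserves the fact that
   all intermediate R-modules are finitely generated; any ideal of R containing i
   is such a module. *)
Require Import Defs.
From mathcomp Require Import all_boot all_order all_algebra.
From mathcomp Require Import boolp classical_sets functions cardinality.
From mathcomp Require Import ring.

Set Implicit Arguments.
Unset Strict Implicit.
Unset Printing Implicit Defensive.

Import GRing.Theory.

Local Open Scope classical_set_scope.
Local Open Scope ring_scope.

(** * Subrings and submodules *)

Lemma subringP (L : fieldType) (T : set L) :
  subring T <-> [/\ T 1, forall x y, T x -> T y -> T (x - y) &
                    forall x y, T x -> T y -> T (x * y)].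
Proof.
split=> -[T1 TB TM]; split=> [|x y|x y].
- by move: T1; rewrite !inE.
- by move=> Tx Ty; have /[!inE] := TB x y (mem_set Tx) (mem_set Ty).
- by move=> Tx Ty; have /[!inE] := TM x y (mem_set Tx) (mem_set Ty).
- by rewrite !inE.
- by rewrite !inE; apply: TB.
- by rewrite !inE; apply: TM.
Qed.

Section SubringTheory.
Variables (L : fieldType) (T : set L).
Hypothesis hT : subring T.

Lemma subring1 : T 1. Proof. by case/subringP: hT. Qed.

Lemma subringB x y : T x -> T y -> T (x - y).
Proof. by case/subringP: hT => _ + _; apply. Qed.

Lemma subringM x y : T x -> T y -> T (x * y).
Proof. by case/subringP: hT => _ _; apply. Qed.

Lemma subring0 : T 0.
Proof. by rewrite -(subrr 1); apply: subringB; apply: subring1. Qed.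

Lemma subringN x : T x -> T (- x).
Proof. by rewrite -sub0r; apply: subringB; apply: subring0. Qed.

Lemma subringD x y : T x -> T y -> T (x + y).
Proof. by move=> Tx Ty; rewrite -[y]opprK; apply/subringB/subringN. Qed.

Lemma subringX x n : T x -> T (x ^+ n).
Proof.
move=> Tx; elim: n => [|n IH]; first exact: subring1.
by rewrite exprS; apply: subringM.
Qed.

Lemma submodule_self : submodule T T.
Proof. by split; [apply: subring0|apply: subringD|apply: subringM]. Qed.

Lemma submodule_colon M : submodule T (colon T M).
Proof.
split=> [y _|x y cx cy z Mz|a x Ta cx z Mz].
- by rewrite mul0r; apply: subring0.
- by rewrite mulrDl; apply: subringD; [apply: cx|apply: cy].
- by rewrite -mulrA; apply/subringM/cx.
Qed.

Lemma submodule_scale g : submodule T [set t * g | t in T].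
Proof.
split=> [|_ _ [s Ts <-] [t Tt <-]|a _ Ta [t Tt <-]].
- by exists 0; [apply: subring0|rewrite mul0r].
- by exists (s + t); [apply: subringD|rewrite mulrDl].
- by exists (a * t); [apply: subringM|rewrite mulrA].
Qed.

Variable M : set L.
Hypothesis hM : submodule T M.

Lemma submodule0 : M 0. Proof. by case: hM. Qed.

Lemma submoduleD x y : M x -> M y -> M (x + y).
Proof. by case: hM => _ + _; apply. Qed.

Lemma submoduleZ a x : T a -> M x -> M (a * x).
Proof. by case: hM => _ _; apply. Qed.

Lemma submoduleN x : M x -> M (- x).
Proof.
by move=> Mx; rewrite -mulN1r; apply/submoduleZ/Mx/subringN/subring1.
Qed.

Lemma submoduleB x y : M x -> M y -> M (x - y).
Proof. by move=> Mx My; apply/submoduleD/submoduleN. Qed.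

Lemma submodule_sum (I : eqType) (s : seq I) F :
  (forall i, i \in s -> M (F i)) -> M (\sum_(i <- s) F i).
Proof.
move=> MF; rewrite big_seq; elim/big_rec: _ => [|i x /MF Fi Mx].
  exact: submodule0.
exact: submoduleD.
Qed.

Lemma submodule_sum_ord n (F : 'I_n -> L) :
  (forall i, M (F i)) -> M (\sum_i F i).
Proof. by move=> MF; apply: submodule_sum => i _. Qed.

End SubringTheory.

(** * Chain conditions *)

Lemma ascending_subset (T : Type) (C : nat -> set T) :
  (forall n, C n `<=` C n.+1) ->
  forall i j, (i <= j)%N -> C i `<=` C j.
Proof.
move=> h i j /subnK <-; elim: (j - i)%N => [//|k IH].
exact/(subset_trans IH)/h.
Qed.

(** Without a maximal member, a choice function sends each member to a strictly larger one, and its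
    iterates form an ascending sequence with no stationary step. *)
Lemma acc_maximal (T : Type) (P : set (set T)) :
  P !=set0 ->
  (forall C : nat -> set T, (forall n, P (C n)) ->
     (forall n, C n `<=` C n.+1) -> exists n, C n = C n.+1) ->
  exists2 S, P S & forall S', P S' -> S `<=` S' -> S' = S.
Proof.
move=> [S0 PS0] acc; apply: contrapT => nomax.
have next (S : {S | P S}) :
    exists S' : {S | P S}, sval S `<=` sval S' /\ sval S' <> sval S.
  apply: contrapT => nS; apply: nomax; exists (sval S); first exact: svalP.
  move=> S' PS' SS'; apply: contrapT => neq; apply: nS.
  by exists (exist _ S' PS').
have [f fP] := choice next.
pose D n := iter n f (exist _ S0 PS0).
have [||n /=] := acc (fun n => sval (D n)).
- by move=> n; apply: svalP.
- by move=> n; have [] := fP (D n).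
- by have [_ neq] := fP (D n); move=> /esym.
Qed.

(** A monotone sequence with no stationary step is injective, since [C i = C j] with [i < j]
    squeezes [C i.+1] in between; its range would then be an infinite chain of overrings. The
    descending case passes to complements. *)
Lemma FC_chain (L : fieldType) (R : set L) (C : nat -> set L) :
  FC_domain R -> (forall n, overring R (C n)) ->
  (forall n, C n `<=` C n.+1) \/ (forall n, C n.+1 `<=` C n) ->
  exists n, C n = C n.+1.
Proof.
move=> hFC hC mono.
have tot i j : C i `<=` C j \/ C j `<=` C i.
  case: mono => mono.
    by case/orP: (leq_total i j) => /(ascending_subset mono) sub;
      [left|right].
  have mono' n : ~` C n `<=` ~` C n.+1 by apply/subsetC/mono.
  by case/orP: (leq_total i j) => /(ascending_subset mono')/subsetC;
    rewrite !setCK => sub; [right|left].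
have fin : finite_set (range C).
  apply: hFC => [_ [n _ <-]|_ _ [i _ <-] [j _ <-]]; first exact: hC.
  exact: tot.
apply: contrapT => nst; have inj : injective C.
  suff lt i j : (i < j)%N -> C i <> C j.
    move=> i j; case: (ltngtP i j) => // [/lt neq /neq //|/lt neq /esym].
    by move=> /neq.
  move=> ltij eqC; apply: nst; exists i; rewrite eqEsubset.
  case: mono => mono.
    by split; [apply: mono|rewrite eqC; apply: ascending_subset mono _ _ ltij].
  have mono' n : ~` C n `<=` ~` C n.+1 by apply/subsetC/mono.
  split; last exact: mono.
  rewrite eqC -[C j]setCK -[C i.+1]setCK; apply: subsetC.
  exact: ascending_subset mono' _ _ ltij.
have sub : [set: nat] `<=` C @^-1` range C by move=> n _; exists n.
apply: infinite_nat; apply: sub_finite_set sub (finite_preimage _ fin).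
by move=> i j _ _; apply: inj.
Qed.

(** * Polynomial relations and the complete integral closure *)

Definition adjoin (L : fieldType) (T : set L) (u : L) : set L :=
  [set x | exists2 p : {poly L}, (forall i, T p`_i) & x = p.[u]].

Section Adjoin.
Variables (L : fieldType) (T : set L).
Hypothesis hT : subring T.

Lemma adjoin_base u : T `<=` adjoin T u.
Proof.
move=> x Tx; exists x%:P; last by rewrite hornerC.
by move=> i; rewrite coefC; case: ifP => // _; apply: subring0.
Qed.

Lemma adjoin_gen u : adjoin T u u.
Proof.
exists 'X; last by rewrite hornerX.
move=> i; rewrite coefX.
by case: (i == 1)%N; [apply: subring1|apply: subring0].
Qed.

Lemma overring_adjoin u : overring T (adjoin T u).
Proof.
split; last exact: adjoin_base.
apply/subringP; split=> [|_ _ [p Tp ->] [q Tq ->]|_ _ [p Tp ->] [q Tq ->]].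
- exact: adjoin_base (subring1 hT).
- exists (p - q); last by rewrite hornerD hornerN.
  by move=> i; rewrite coefB; apply: subringB.
- exists (p * q); last by rewrite hornerM.
  move=> i; rewrite coefM; apply: submodule_sum_ord.
    exact: submodule_self.
  by move=> j; apply: subringM.
Qed.

(** Stationarity at [k] puts [u ^+ (2 ^ k)] in [T[u ^+ (2 ^ k.+1)]]. The relation subtracts from
    ['X^(2 ^ k)] only monomials whose exponents are multiples of [2 ^ k.+1], so the coefficient 1
    survives. *)
Lemma FC_poly u : FC_domain T ->
  exists p : {poly L}, [/\ forall i, T p`_i, p.[u] = 0 &
                           exists j, p`_j = 1].
Proof.
move=> hFC; pose C k := adjoin T (u ^+ (2 ^ k)).
have [||k eqC] := @FC_chain L T C hFC.
- by move=> k; apply: overring_adjoin.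
- right=> k _ [p Tp ->]; exists (p \Po 'X^2).
    by move=> i; rewrite coef_comp_poly_Xn //; case: ifP => // _; apply: subring0.
  by rewrite horner_comp hornerXn -exprM -expnSr.
have [q Tq eq_q] : C k.+1 (u ^+ (2 ^ k)) by rewrite -eqC; apply: adjoin_gen.
exists ('X^(2 ^ k) - (q \Po 'X^(2 ^ k.+1))); split.
- move=> i; rewrite coefB coefXn coef_comp_poly_Xn ?expn_gt0 //.
  apply: subringB => //.
    by case: (i == _); [apply: subring1|apply: subring0].
  by case: ifP => // _; apply: subring0.
- by rewrite hornerD hornerN horner_comp !hornerXn -eq_q subrr.
- exists (2 ^ k)%N.
  by rewrite coefB coefXn eqxx coef_comp_poly_Xn ?expn_gt0 // dvdn_Pexp2l //
    ltnn subr0.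
Qed.

End Adjoin.

Definition completely_integrally_closed (L : fieldType) (T : set L) : Prop :=
  forall x d, T d -> d != 0 -> (forall n, T (d * x ^+ n)) -> T x.

(** Invertibility of the fractional ideal [(1, u)]: both [s] and [t] lie in [(T : (1, u))], and
    [s * 1 + t * u = 1]. *)
Definition prufer (L : fieldType) (T : set L) : Prop :=
  forall u, exists s t,
    [/\ T s, T (s * u), T t, T (t * u) & s + t * u = 1].

Section CompletelyIntegrallyClosed.
Variables (L : fieldType) (T : set L).
Hypothesis hT : domain_with_quotient_field T.
Hypothesis cicT : completely_integrally_closed T.

Let subT : subring T := proj1 hT.

(** With [c] the leading coefficient and [n] the degree, [c * u] is integral over [T]. Writing
    [u = a / b], the single denominator [b ^+ n] clears every power of [c * u]: directly for
    exponents below [n], and through the integral equation above. *)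
Lemma lead_coef_mul_root (p : {poly L}) u :
  (forall i, T p`_i) -> p.[u] = 0 -> T (lead_coef p * u).
Proof.
move=> Tp pu0; have [->|p0] := eqVneq p 0.
  by rewrite lead_coef0 mul0r; apply: subring0.
have [a [b [Ta Tb b0 eu]]] := proj2 hT u.
set c := lead_coef p; have Tc : T c by apply: Tp.
move: pu0; rewrite horner_coef (polySpred p0); set n := (size p).-1.
rewrite big_ord_recr /= -[p`_n]/c => /eqP.
rewrite addrC addr_eq0 => /eqP eqn.
apply: (@cicT _ (b ^+ n)) => [||k]; first exact: subringX.
  exact: expf_neq0.
elim/ltn_ind: k => k IH; have [ltkn|lenk] := ltnP k n.
  have -> : b ^+ n * (c * u) ^+ k = b ^+ (n - k) * (c * a) ^+ k.
    rewrite -[in LHS](subnK (ltnW ltkn)) exprD -mulrA -exprMn eu.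
    by congr (_ * _ ^+ _); field.
  by apply: subringM => //; apply: subringX => //; apply: subringM.
case En : n eqn IH lenk => [|m] eqn IH lenk.
  move: eqn; rewrite big_ord0 expr0 mulr1 oppr0 => /eqP.
  by rewrite lead_coef_eq0 (negPf p0).
have -> : b ^+ m.+1 * (c * u) ^+ k =
    - \sum_(i < m.+1) (p`_i * c ^+ (m - i)) *
                      (b ^+ m.+1 * (c * u) ^+ (k - m.+1 + i)).
  rewrite -[in LHS](subnK lenk) exprD [(c * u) ^+ m.+1]exprMn.
  rewrite [c ^+ m.+1]exprSr -[c ^+ m * c * _]mulrA eqn !(mulrN, mulNr).
  rewrite !mulr_sumr; congr (- _); apply: eq_bigr => i _.
  have -> : c ^+ m = c ^+ (m - i) * c ^+ i.
    by rewrite -exprD subnK // -ltnS.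
  by rewrite exprD [(c * u) ^+ i]exprMn; ring.
apply: subringN => //; apply: submodule_sum_ord; first exact: submodule_self.
move=> i; apply: subringM => //.
  by apply: subringM => //; apply: subringX.
by apply: IH; rewrite -[ltnRHS](subnK lenk) ltn_add2l.
Qed.

(** Induction on the degree: as [c * u] is in [T] for the leading coefficient [c], the term
    [c X^(m+1)] can be folded into [(c * u) X^m], which keeps the root [u] and lowers the degree.
    Only the two top coefficients change. *)
Lemma coef_root_split (p : {poly L}) u i :
  (forall i, T p`_i) -> p.[u] = 0 ->
  exists s t, [/\ T s, T (s * u), T t, T (t * u) & s + t * u = p`_i].
Proof.
elim: (size p) {-2}p (leqnn (size p)) i => {p} [|n IH] p.
  rewrite leqn0 size_poly_eq0 => /eqP -> i _ _; exists 0, 0.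
  by rewrite coef0 mul0r addr0; split=> //; apply: subring0.
move=> szp i Tp pu0; have Tcu := lead_coef_mul_root Tp pu0.
have T0 := subring0 subT.
have [szn|szn] := leqP (size p) n; first exact: IH.
have {szp szn} szp : size p = n.+1 by apply/eqP; rewrite eqn_leq szp.
move: Tcu; rewrite lead_coefE szp /= => Tcu.
case: n => [|m] in IH szp Tcu *.
  have eqp := size1_polyC (eq_leq szp).
  move: pu0 szp; rewrite eqp hornerC => ->.
  by rewrite size_polyC eqxx.
pose c := p`_m.+1; rewrite -/c in Tcu.
pose q := p - c *: 'X^(m.+1) + (c * u) *: 'X^m.
have qE j : q`_j = p`_j - c * (j == m.+1)%:R + (c * u) * (j == m)%:R.
  by rewrite !coefE.
have szq : (size q <= m.+1)%N.
  apply/leq_sizeP => j lemj; rewrite qE (gtn_eqF lemj) mulr0 addr0.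
  case: (eqVneq j m.+1) => [->|nej]; first by rewrite mulr1 subrr.
  by rewrite mulr0 subr0 nth_default // szp ltn_neqAle eq_sym nej.
have [||s [t [Ts Tsu Tt Ttu eqst]]] := IH q szq i.
- move=> j; rewrite qE; apply: subringD => //.
    by apply: subringB => //; case: eqP => _; rewrite ?mulr1 ?mulr0 //; apply: Tp.
  by case: eqP => _; rewrite ?mulr1 ?mulr0.
- rewrite !hornerE pu0 exprS; ring.
case: (eqVneq i m.+1) => [->|nei1].
  exists c, 0; rewrite !mul0r addr0; split=> //; exact: Tp.
case: (eqVneq i m) => [ei|nei].
  (* The folding added [c * u] to this coefficient; it is removed from the [t]-part. *)
  exists s, (t - c); split=> //.
  - by apply: subringB => //; apply: Tp.
  - by rewrite mulrBl; apply: subringB.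
  - move: eqst; rewrite qE (negPf nei1) ei eqxx => eqst.
    by rewrite mulrBl addrA eqst mulr0 mulr1 subr0 addrK.
exists s, t; split=> //.
by rewrite eqst qE (negPf nei1) (negPf nei) !mulr0 subr0 addr0.
Qed.

Lemma cic_integrally_closed : integrally_closed T.
Proof.
move=> a b Ta Tb b0 [p [monp polyT /rootP rootp]].
rewrite -[a / b]mul1r -(monicP monp); apply: lead_coef_mul_root => // i.
have [lti|lei] := ltnP i (size p); last first.
  by rewrite nth_default //; apply: subring0.
by have /allP/(_ _ (mem_nth 0 lti)) := polyT; rewrite inE.
Qed.

Lemma cic_prufer (R : set L) :
  subring R -> FC_domain R -> R `<=` T -> prufer T.
Proof.
move=> hR hFC sRT u; have [p [Rp pu0 [j pj1]]] := FC_poly hR u hFC.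
by rewrite -pj1; apply: coef_root_split => // i; apply: sRT.
Qed.

End CompletelyIntegrallyClosed.

(** * The conductor of the complete integral closure *)

Section Conductor.
Variables (L : fieldType) (R : set L).
Hypothesis hR : domain_with_quotient_field R.
Hypothesis hFC : FC_domain R.

Let subR : subring R := proj1 hR.
Let Rbar := complete_integral_closure R.

Lemma overring_quotient (T : set L) :
  overring R T -> domain_with_quotient_field T.
Proof.
move=> [subT sRT]; split=> // x.
by have [a [b [Ra Rb b0 ex]]] := proj2 hR x; exists a, b; split=> //; apply: sRT.
Qed.

(* [FC] yields a largest overring [S] with [(R : S) != 0]; adjoining to [S] an
   almost integral element preserves this property, so [S] is the complete
   integral closure. *)
Lemma complete_integral_closure_conductor :
  overring R Rbar /\ exists2 a, a != 0 & colon R Rbar a.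
Proof.
pose P S := overring R S /\ exists2 a, a != 0 & colon R S a.
have PR : P !=set0.
  exists R; split; first by split.
  by exists 1; [apply: oner_neq0|move=> y; rewrite mul1r].
have [|S [[subS sRS] [a a0 aS]] maxS] := acc_maximal PR.
  move=> C PC Cn; apply: (FC_chain hFC); last by left.
  by move=> n; have [] := PC n.
suff <- : S = Rbar by split; [split|exists a].
have Ra : R a by rewrite -[a]mulr1; apply: aS (subring1 subS).
rewrite eqEsubset; split=> x; first move=> Sx.
  exists a; split=> // n _; apply: aS; exact: subringX.
move=> [d [Rd d0 Rdx]].
have Rdx' n : R (d * x ^+ n) by case: n => [|n]; rewrite ?mulr1 //; apply: Rdx.
have [subSx sSSx] := overring_adjoin subS x.
rewrite -(maxS (adjoin S x)) //; first exact: adjoin_gen.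
split; first by split=> // y /sRS/sSSx.
(* In [a * d * p.[x]] the factor [a] absorbs the coefficients of [p] and [d] absorbs the powers of
   [x]. *)
exists (a * d); first exact: mulf_neq0.
move=> _ [p Sp ->]; rewrite horner_coef mulr_sumr.
apply: submodule_sum_ord; first exact: submodule_self.
move=> i; rewrite mulrACA; apply: subringM => //; exact: aS.
Qed.

Lemma cic_complete_integral_closure : completely_integrally_closed Rbar.
Proof.
have [[subT sRT] [a a0 aT]] := complete_integral_closure_conductor.
move=> x d Td d0 Tdx; exists (a * d); split=> [||n _]; first exact: aT.
  exact: mulf_neq0.
by rewrite -mulrA; apply: aT (Tdx n).
Qed.

(** With [A = (R : Rbar)], an element [x] of [(R : A)] satisfies [x A <= A], because [A] is an ideal
    of [Rbar]. Hence all [x ^+ n * a] lie in [A], and [a] shows that [x] is almost integral. *)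
Lemma colon_colon_closure : colon R (colon R Rbar) = Rbar.
Proof.
have [[subT sRT] [a a0 aT]] := complete_integral_closure_conductor.
rewrite eqEsubset; split=> x; last first.
  by move=> Tx y; rewrite mulrC; apply.
move=> xA; have xAA y : colon R Rbar y -> colon R Rbar (x * y).
  move=> Ay z Tz; rewrite -mulrA; apply: xA => t Tt.
  by rewrite -mulrA; apply: Ay; apply: subringM.
have Axn n : colon R Rbar (x ^+ n * a).
  elim: n => [|n IH]; first by rewrite mul1r.
  by rewrite exprS -mulrA; apply: xAA.
have R1 b : colon R Rbar b -> R b.
  by move=> Ab; rewrite -[b]mulr1; apply: Ab (subring1 subT).
exists a; split=> [||n _] //; first exact: R1.
by rewrite mulrC; apply: R1.
Qed.

End Conductor.

(** * Invertible ideals *)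

(** The list exhibits 1 as an element of the product [J (T : J)]; the pairs serve as explicit dual
    generators later. *)
Definition invertible (L : fieldType) (T J : set L) : Prop :=
  exists2 s : seq (L * L), (forall x, x \in s -> J x.1 /\ colon T J x.2) &
    \sum_(x <- s) x.1 * x.2 = 1.

Definition add_generator (L : fieldType) (T J : set L) (u : L) : set L :=
  [set x | exists y t, [/\ J y, T t & x = y + t * u]].

Lemma nonzero_elt (L : fieldType) (J : set L) :
  J 0 -> J <> [set 0] -> exists2 z, J z & z != 0.
Proof.
move=> J0 nJ; apply: contrapT => nz; apply: nJ; rewrite eqEsubset.
split=> [x Jx|x -> //] /=; apply/eqP; apply: contrapT => /negP x0.
by apply: nz; exists x.
Qed.

Lemma set1_neq (L : fieldType) (J : set L) z : J z -> z != 0 -> J <> [set 0].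
Proof. by move=> Jz z0 eJ; move: Jz; rewrite eJ /= => /eqP; apply/negP. Qed.

Section AddGenerator.
Variables (L : fieldType) (T : set L).
Hypothesis subT : subring T.

Lemma sub_add_generator J u : J `<=` add_generator T J u.
Proof.
by move=> x Jx; exists x, 0; rewrite mul0r addr0; split=> //; apply: subring0.
Qed.

Lemma add_generator_gen J u : J 0 -> add_generator T J u u.
Proof.
by move=> J0; exists 0, 1; rewrite mul1r add0r; split=> //; apply: subring1.
Qed.

Lemma add_generator_sub J M u :
  submodule T M -> J `<=` M -> M u -> add_generator T J u `<=` M.
Proof.
move=> hM sJM Mu _ [y [t [/sJM My Tt ->]]].
by apply: (submoduleD hM) => //; apply: (submoduleZ hM).
Qed.

Lemma submodule_add_generator J u :
  submodule T J -> submodule T (add_generator T J u).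
Proof.
move=> hJ; split=> [|x y|a x Ta].
- exact/sub_add_generator/(submodule0 hJ).
- move=> [y1 [t1 [Jy1 Tt1 ->]]] [y2 [t2 [Jy2 Tt2 ->]]].
  exists (y1 + y2), (t1 + t2); split; [exact: (submoduleD hJ)|exact: subringD|].
  by ring.
- move=> [y1 [t1 [Jy1 Tt1 ->]]]; exists (a * y1), (a * t1).
  by split; [exact: (submoduleZ hJ)|exact: subringM|ring].
Qed.

Lemma finitely_generated_add_generator J u :
  finitely_generated T J -> finitely_generated T (add_generator T J u).
Proof.
move=> [n [g ->]]; exists n.+1, (fun i => oapp g u (unlift ord0 i)).
rewrite eqEsubset; split=> x.
  move=> [_ [t [[c Tc ->] Tt ->]]].
  exists (fun i => oapp c t (unlift ord0 i)).
    by move=> i; case: (unlift ord0 i).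
  rewrite big_ord_recl unlift_none /= addrC; congr (_ + _).
  by apply: eq_bigr => i _; rewrite liftK.
move=> [c Tc ->]; rewrite big_ord_recl unlift_none /=.
exists (\sum_(i < n) c (lift ord0 i) * g i), (c ord0); split=> //.
  by exists (fun i => c (lift ord0 i)).
by rewrite addrC; congr (_ + _); apply: eq_bigr => i _; rewrite liftK.
Qed.

Lemma finitely_generated_zero : finitely_generated T [set 0].
Proof.
exists 0%N, (fun=> 0); rewrite eqEsubset; split=> x /=.
  by move=> ->; exists (fun=> 0); [case|rewrite big_ord0].
by move=> [c _ ->]; rewrite big_ord0.
Qed.

Lemma finitely_generated_scale J w :
  finitely_generated T J -> finitely_generated T [set w * x | x in J].
Proof.
move=> [n [g ->]]; exists n, (fun i => w * g i); rewrite eqEsubset; split=> x /=.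
  move=> [_ [c Tc ->] <-]; exists c => //.
  by rewrite mulr_sumr; apply: eq_bigr => i _; rewrite mulrCA.
move=> [c Tc ->]; exists (\sum_(i < n) c i * g i); first by exists c.
by rewrite mulr_sumr; apply: eq_bigr => i _; rewrite mulrCA.
Qed.

End AddGenerator.

Section Invertible.
Variables (L : fieldType) (T : set L).
Hypothesis subT : subring T.

Lemma invertible_scale g : g != 0 -> invertible T [set t * g | t in T].
Proof.
move=> g0; exists [:: (g, g^-1)]; last by rewrite big_seq1 mulfV.
move=> x; rewrite inE => /eqP -> /=; split.
  by exists 1; [apply: subring1|rewrite mul1r].
by move=> _ [t Tt <-]; rewrite mulrC mulfK.
Qed.

Lemma finitely_generated_principal g : finitely_generated T [set t * g | t in T].
Proof.
exists 1%N, (fun=> g); rewrite eqEsubset; split=> x /=.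
  by move=> [t Tt <-]; exists (fun=> t); rewrite ?big_ord1.
by move=> [c Tc ->]; exists (c ord0); rewrite ?big_ord1.
Qed.

Lemma invertible_nonzero J :
  invertible T J -> exists2 z, J z & z != 0.
Proof.
move=> [s sJ s1]; apply: contrapT => nz.
move/eqP: s1; apply/negP; rewrite big_seq big1 => [|x /sJ [Jx _]].
  by rewrite eq_sym oner_eq0.
have [->|x0] := eqVneq x.1 0; first by rewrite mul0r.
by case: nz; exists x.1.
Qed.

Lemma invertible_reflexive J :
  submodule T J -> invertible T J -> colon T (colon T J) `<=` J.
Proof.
move=> hJ [s sJ s1] x cx; rewrite -[x]mulr1 -s1 mulr_sumr.
apply: (submodule_sum hJ) => y /sJ[Jy cy].
rewrite mulrCA mulrC; apply: (submoduleZ hJ) => //; exact: cx.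
Qed.

Lemma invertible_absorb J k :
  invertible T J -> (forall x, J x -> J (k * x)) -> T k.
Proof.
move=> [s sJ s1] kJ; rewrite -[k]mulr1 -s1 mulr_sumr.
apply: (submodule_sum (submodule_self subT)) => y /sJ[Jy cy].
by rewrite mulrA mulrC; apply: cy; apply: kJ.
Qed.

(** A homogeneous form for the ideal [(a, u)], obtained from [(1, u / a)] by dividing by [a].
    Stating the identity after multiplication by [a] covers [a = 0] as well. *)
Lemma prufer_pair a u : prufer T ->
  exists s t, [/\ T (s * a), T (s * u), T (t * a), T (t * u) &
                 a * (s * a + t * u) = a].
Proof.
move=> pT; have [->|a0] := eqVneq a 0.
  by exists 0, 0; rewrite !mul0r; split=> //; apply: subring0.
have [s [t [Ts Tsu Tt Ttu eqst]]] := pT (u / a).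
exists (s / a), (t / a); split; rewrite ?divfK //.
- by rewrite mulrAC -mulrA.
- by rewrite mulrAC -mulrA.
- by rewrite -[RHS]mulr1 -eqst; congr (_ * (_ + _)); rewrite mulrAC -mulrA.
Qed.

(* If [1 = \sum a b] witnesses the invertibility of [J], then locally [J] is
   generated by one of the [a], so [J + T u] is locally generated by [a] and
   [u]; the witness combines the [b] with witnesses for the pairs [(a, u)]. *)
Lemma invertible_add_generator J u :
  prufer T -> submodule T J -> invertible T J ->
  invertible T (add_generator T J u).
Proof.
move=> pT hJ [s sJ s1].
have [f fP] := choice (fun a => prufer_pair a u pT).
have [g gP] := choice fP.
have colonJ c w : colon T J c -> T (w * u) -> forall a, J a -> T (w * a) ->
    colon T (add_generator T J u) (a * c * w).
  move=> cc Twu a Ja Twa _ [y [t [Jy Tt ->]]].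
  have -> : a * c * w * (y + t * u) = c * y * (w * a) + c * a * (t * (w * u)).
    by ring.
  apply: (subringD subT); first by apply: (subringM subT) => //; exact: cc.
  by apply: (subringM subT); [exact: cc|exact: subringM].
exists ((u, \sum_(x <- s) x.1 * x.2 * g x.1) ::
        [seq (x.1, x.1 * x.2 * f x.1) | x <- s]).
  move=> x; rewrite inE => /orP[/eqP ->|/mapP[y ys ->]] /=.
    split; first exact: add_generator_gen (submodule0 hJ).
    apply: submodule_sum => [|y ys]; first exact: submodule_colon.
    have [Jy cy] := sJ y ys; have [_ _ Tga Tgu _] := gP y.1.
    exact: colonJ.
  have [Jy cy] := sJ y ys; have [Tfa Tfu _ _ _] := gP y.1.
  by split; [apply: sub_add_generator|apply: colonJ].
rewrite big_cons big_map /= mulr_sumr -big_split /= -[RHS]s1.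
apply: eq_bigr => x _; have [_ _ _ _ eqx] := gP x.1.
by rewrite -[in RHS]eqx; ring.
Qed.

End Invertible.

Section MoriChains.
Variables (L : fieldType) (R : set L).
Hypothesis subR : subring R.
Hypothesis hMori : mori R.

(** Each [(R : F n)] is divisorial because a triple colon equals a single one, so the ascending
    chain condition on [v]-ideals applies directly. *)
Lemma mori_colon (F : nat -> set L) :
  (forall n, colon R (F n) `<=` R) ->
  (forall n, exists2 z, z != 0 & colon R (F n) z) ->
  (forall n, colon R (F n) `<=` colon R (F n.+1)) ->
  exists N, forall n, (N <= n)%N -> colon R (F n) = colon R (F N).
Proof.
move=> FR Fnz Fmono; apply: hMori => // n; split=> //; split.
  split; first exact: submodule_colon.
    by have [z z0 Fz] := Fnz n; apply: set1_neq Fz z0.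
  exists 1; split=> [||x /FR]; [exact: subring1|exact: oner_neq0|].
  by rewrite mul1r.
rewrite eqEsubset; split=> x cx y cy; first by rewrite mulrC; apply: cy.
by apply: cx => z cz; rewrite mulrC; apply: cz.
Qed.

End MoriChains.

(** * Maximal ideals, localizations and valuation overrings *)

Section MaximalIdeals.
Variables (L : fieldType) (T : set L).
Hypothesis subT : subring T.

Lemma ideal_eq_ring J : ideal T J -> J 1 -> J = T.
Proof.
move=> [hJ sJT] J1; rewrite eqEsubset; split=> // x Tx.
by rewrite -[x]mulr1; apply: (submoduleZ hJ).
Qed.

Lemma ideal_add_generator J u :
  ideal T J -> T u -> ideal T (add_generator T J u).
Proof.
move=> [hJ sJT] Tu; split; first exact: submodule_add_generator.
exact: add_generator_sub (submodule_self subT) sJT Tu.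
Qed.

Lemma maximal_ideal_inv M u : maximal_ideal T M -> T u -> ~ M u ->
  exists2 t, T t & M (1 - t * u).
Proof.
move=> [idM nMT maxM] Tu nMu.
have [|eqM|eqT] := maxM _ (ideal_add_generator idM Tu).
- exact: sub_add_generator.
- case: nMu; rewrite -eqM; apply: add_generator_gen => //.
  by case: idM => hM _; apply: submodule0 hM.
- have := subring1 subT; rewrite -{1}eqT => -[y [t [My Tt e1]]].
  by exists t; rewrite // e1 addrK.
Qed.

Lemma maximal_ideal_not1 M : maximal_ideal T M -> ~ M 1.
Proof. by move=> [idM nMT _] /(ideal_eq_ring idM). Qed.

Lemma maximal_ideal_prime M : maximal_ideal T M -> prime_ideal T M.
Proof.
move=> maxM; have [idM nMT _] := maxM; have [hM sMT] := idM.
split=> //; first exact: maximal_ideal_not1.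
move=> x y Tx Ty Mxy; have [Mx|nMx] := pselect (M x); [by left|right].
have [t Tt Mt] := maximal_ideal_inv maxM Tx nMx.
have -> : y = y * (1 - t * x) + t * (x * y) by ring.
by apply: (submoduleD hM); apply: (submoduleZ hM).
Qed.

(** Let [J] contain [P] and some [x] outside [P]. For [b] in [(T : J)], [x b P] is in [P], so [b P]
    is in [P] by primality, and [b] is in [T] by invertibility of [P]. Thus [(T : J)] lies in [T],
    which forces 1 into [J]. *)
Lemma prime_ideal_maximal :
  (forall I, ideal T I -> I <> [set 0] -> invertible T I) ->
  forall P, prime_ideal T P -> P <> [set 0] -> maximal_ideal T P.
Proof.
move=> inv P [idP nP1 primeP] P0; have [hP sPT] := idP; split=> //.
  by move=> eqPT; apply: nP1; rewrite eqPT; apply: subring1.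
move=> J idJ sPJ; have [sJP|nsJP] := pselect (J `<=` P).
  by left; rewrite eqEsubset.
right; have [x /not_implyP [Jx nPx]] := (existsNP _).2 nsJP.
have [hJ sJT] := idJ; have [p Pp p0] := nonzero_elt (submodule0 hP) P0.
have [s sJ s1] := inv J idJ (set1_neq (sPJ _ Pp) p0).
apply: ideal_eq_ring => //; rewrite -s1.
apply: (submodule_sum hJ) => y /sJ[Jy cy].
rewrite mulrC; apply: (submoduleZ hJ) => //.
apply: (invertible_absorb subT (inv P idP P0)) => q Pq.
have Tyq : T (y.2 * q) by apply/cy/sPJ.
have [|/nPx//|//] := primeP x (y.2 * q) (sJT _ Jx) Tyq.
by rewrite mulrA [x * _]mulrC; apply: (submoduleZ hP) => //; apply: cy.
Qed.

End MaximalIdeals.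

(** * Localizations and finiteness of the set of maximal ideals *)

Definition localization (L : fieldType) (T S : set L) : set L :=
  [set x | exists a s, [/\ T a, S s & x = a / s]].

Section Localization.
Variables (L : fieldType) (T S : set L).
Hypotheses (subT : subring T) (sST : S `<=` T) (S1 : S 1) (nS0 : ~ S 0).
Hypothesis SM : forall x y, S x -> S y -> S (x * y).

Lemma overring_localization : overring T (localization T S).
Proof.
have nz s : S s -> s != 0 by move=> Ss; apply/eqP => s0; apply: nS0; rewrite -s0.
split; last by move=> x Tx; exists x, 1; rewrite divr1.
apply/subringP; split.
- by exists 1, 1; split=> //; [exact: subring1|rewrite divr1].
- move=> _ _ [a [s [Ta Ss ->]]] [b [t [Tb St ->]]].
  exists (a * t - b * s), (s * t); split; last by field; rewrite !nz.
    by apply: subringB => //; apply: subringM => //; apply: sST.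
  exact: SM.
- move=> _ _ [a [s [Ta Ss ->]]] [b [t [Tb St ->]]].
  exists (a * b), (s * t); split; [exact: subringM|exact: SM|].
  by field; rewrite !nz.
Qed.

End Localization.

Section Semilocal.
Variables (L : fieldType) (T : set L).
Hypothesis subT : subring T.

(* Inverting the elements of [T] outside the first [n] of infinitely many
   maximal ideals would give a strictly decreasing sequence of overrings. *)
Lemma FC_semilocal :
  (forall C : nat -> set L, (forall n, overring T (C n)) ->
     (forall n, C n.+1 `<=` C n) -> exists n, C n = C n.+1) ->
  semilocal T.
Proof.
move=> dcc; apply: contrapT => /infiniteP/pcard_leP[f].
have maxf n : maximal_ideal T (f n) by apply: 'funS_f.
have injf i j : f i = f j -> i = j.
  by move=> eqf; apply: ('inj_f _ _ eqf); rewrite inE.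
have idf n : submodule T (f n) by have [[]] := maxf n.
have sfT n : f n `<=` T by have [[]] := maxf n.
have f0 n : f n 0 by apply: submodule0 (idf n).
have coprime i j : i <> j -> exists y, f i y /\ f j (1 - y).
  move=> neij; have [y fiy nfjy] : exists2 y, f i y & ~ f j y.
    apply: contrapT => nex; have sij : f i `<=` f j.
      by move=> y fiy; apply: contrapT => nfjy; apply: nex; exists y.
    have [_ _ maxi] := maxf i; have [idj njT _] := maxf j.
    by have [/injf /esym|] := maxi (f j) idj sij.
  have [t Tt ft] := maximal_ideal_inv subT (maxf j) (sfT _ _ fiy) nfjy.
  by exists (t * y); split=> //; apply: (submoduleZ (idf i)).
pose S n := [set s | T s /\ forall i, (i <= n)%N -> ~ f i s].
have [||n eqC] := dcc (fun n => localization T (S n)).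
- move=> n; apply: overring_localization => //.
  + by move=> x [].
  + split=> [|i _]; [exact: subring1|exact: maximal_ideal_not1 (maxf i)].
  + by case=> _ /(_ 0%N isT); apply.
  + move=> x y [Tx nx] [Ty ny]; split=> [|i lein]; first exact: subringM.
    have [_ _ primei] := maximal_ideal_prime subT (maxf i).
    by case/(primei _ _ Tx Ty) => [/nx|/ny]; apply.
- move=> n _ [a [s [Ta [Ts ns] ->]]]; exists a, s; split=> //.
  by split=> // i lein; apply: ns; apply: leqW.
have [y yP] : exists y : nat -> L, forall i, (i <= n)%N ->
    f i (y i) /\ f n.+1 (1 - y i).
  suff /choice[y yP] : forall i, exists y, (i <= n)%N -> f i y /\ f n.+1 (1 - y).
    by exists y.
  move=> i; have [lein|] := leqP i n; last by exists 0.
  have [|y yP] := coprime i n.+1; last by exists y.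
  by move=> ein; move: lein; rewrite ein ltnn.
(* The product is 1 modulo [f n.+1] and 0 modulo the earlier [f i]. So [m] lies in [f n.+1] and in
   no earlier [f i], and [m^-1] separates the two localizations. *)
pose m := 1 - \prod_(i < n.+1) y i.
have fm : f n.+1 m.
  rewrite /m; elim/big_rec: _ => [|i x _ fx]; first by rewrite subrr.
  have [fiy fy] := yP i (ltn_ord i).
  have -> : 1 - y i * x = (1 - y i) + y i * (1 - x) by ring.
  apply: (submoduleD (idf _)) => //; apply: (submoduleZ (idf _)) => //.
  exact: sfT fiy.
have nfm i : (i <= n)%N -> ~ f i m.
  move=> lein fim; apply: (maximal_ideal_not1 (maxf i)).
  rewrite -[1](subrK (\prod_(i < n.+1) y i)); apply: (submoduleD (idf _)) => //.
  rewrite (bigD1 (Ordinal (lein : (i < n.+1)%N))) //= mulrC.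
  have [fiy _] := yP i lein; apply: (submoduleZ (idf _)) => //.
  elim/big_rec: _ => [|j x _ Tx]; first exact: subring1.
  apply: subringM => //; have [fjy _] := yP j (ltn_ord j); exact: sfT fjy.
have m0 : m != 0 by apply/eqP => m0; apply: (nfm 0%N) => //; rewrite m0.
have [a [s [Ta [Ts ns] eqm]]] : localization T (S n.+1) m^-1.
  rewrite -eqC; exists 1, m; split; rewrite ?mul1r //; first exact: subring1.
  by split=> //; apply: sfT fm.
have s0 : s != 0 by apply/eqP => s0; apply: (ns 0%N) => //; rewrite s0.
apply: (ns n.+1 (leqnn _)).
have <- : a * m = s by rewrite -[a](divfK s0) -eqm mulrAC mulVf // mul1r.
by apply: (submoduleZ (idf _)).
Qed.

End Semilocal.

(* The alternative [z = 0] is needed because [0^-1 = 0] belongs to [V]. *)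
Definition nonunits (L : fieldType) (V : set L) : set L :=
  [set z | V z /\ (z = 0 \/ ~ V z^-1)].

Lemma zero_ideal_prime (L : fieldType) (T : set L) :
  subring T -> prime_ideal T [set 0].
Proof.
move=> subT; split=> [||x y _ _ /= /eqP].
- split=> [|x ->]; last exact: subring0.
  by split=> [//|x y -> ->|a x _ ->] /=; rewrite ?addr0 ?mulr0.
- by move=> /eqP; rewrite oner_eq0.
- by rewrite mulf_eq0 => /orP[] /eqP; [left|right].
Qed.

Section Valuation.
Variables (L : fieldType) (V : set L).
Hypotheses (subV : subring V) (valV : forall x, x != 0 -> V x \/ V x^-1).

(** For sums: one of [z / w] and [w / z] is in [V]. If it is [z / w], then
    [w^-1 = (z / w + 1) * (z + w)^-1], so a unit [z + w] would make [w] a unit. *)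
Lemma nonunits_prime : prime_ideal V (nonunits V).
Proof.
have nuD z w : z != 0 -> w != 0 -> V z -> V w -> ~ V w^-1 ->
    V (z / w) -> nonunits V (z + w).
  move=> z0 w0 Vz Vw nVw Vzw; split; first exact: subringD.
  have [->|zw0] := eqVneq (z + w) 0; [by left|right=> Vi; apply: nVw].
  have -> : w^-1 = (z / w + 1) * (z + w)^-1 by field; rewrite w0 zw0.
  by apply: subringM => //; apply: subringD => //; apply: subring1.
split.
- split; last by move=> x [].
  split=> [|z w [Vz hz] [Vw hw]|c z Vc [Vz hz]].
  + by split; [exact: subring0|left].
  + have [->|z0] := eqVneq z 0; first by rewrite add0r; split.
    have [->|w0] := eqVneq w 0; first by rewrite addr0; split.
    case: hz => [/eqP|nVz]; first by rewrite (negPf z0).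
    case: hw => [/eqP|nVw]; first by rewrite (negPf w0).
    have [] := valV (mulf_neq0 z0 (invr_neq0 w0)) => Vzw; first exact: nuD.
    by rewrite addrC; apply: nuD => //; rewrite -[w / z]invrK invf_div.
  + split; first exact: subringM.
    have [->|c0] := eqVneq c 0; first by left; rewrite mul0r.
    case: hz => [->|nVz]; [by left; rewrite mulr0|right=> Vi; apply: nVz].
    have -> : z^-1 = c * (c * z)^-1 by rewrite invfM mulrA mulfV // mul1r.
    exact: subringM.
- by move=> [_ [/eqP|]]; rewrite ?oner_eq0 // invr1; apply; apply: subring1.
- move=> x y Vx Vy [_ hxy]; have [->|x0] := eqVneq x 0.
    by left; split; [exact: subring0|left].
  have [->|y0] := eqVneq y 0; first by right; split; [exact: subring0|left].
  have [Vxi|nVx] := pselect (V x^-1); last by left; split=> //; right.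
  have [Vyi|nVy] := pselect (V y^-1); last by right; split=> //; right.
  case: hxy => [/eqP|[]]; first by rewrite mulf_eq0 (negPf x0) (negPf y0).
  by rewrite invfM; apply: subringM.
Qed.

End Valuation.

(** * Primes and dimension of the overrings of a Pruefer domain *)

Section PruferOverrings.
Variables (L : fieldType) (T : set L).
Hypothesis hT : domain_with_quotient_field T.
Hypothesis pT : prufer T.
Hypothesis primeT :
  forall P, prime_ideal T P -> P <> [set 0] -> maximal_ideal T P.

Let subT : subring T := proj1 hT.

Lemma contraction_prime V P : subring V -> T `<=` V ->
  prime_ideal V P -> prime_ideal T (P `&` T).
Proof.
move=> subV sTV [[hP sPV] nP1 primeP]; split.
- split; last by move=> x [].
  split=> [|x y [Px Tx] [Py Ty]|c x Tc [Px Tx]].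
  + by split; [exact: submodule0 hP|exact: subring0].
  + by split; [exact: (submoduleD hP)|exact: subringD].
  + by split; [apply: (submoduleZ hP) => //; apply: sTV|exact: subringM].
- by case.
- move=> x y Tx Ty [Pxy _].
  by have [] := primeP x y (sTV _ Tx) (sTV _ Ty) Pxy; [left|right].
Qed.

(** Denominators make [P1] contract to a nonzero, hence maximal, ideal of [T], so [P2] has the same
    contraction. For [z] in [P2], write [1 = s + t * z]: then [s] is outside [P1], while [s * z] is
    in [P2] and in [T], hence in [P1]; so [z] is in [P1]. *)
Lemma overring_prime_subset V P1 P2 : subring V -> T `<=` V ->
  prime_ideal V P1 -> prime_ideal V P2 -> P1 <> [set 0] ->
  P1 `<=` P2 -> P2 `<=` P1.
Proof.
move=> subV sTV prP1 prP2 P1n0 s12 z P2z.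
have [[hP1 sP1V] nP11 primeP1] := prP1; have [[hP2 sP2V] nP21 _] := prP2.
have max1 : maximal_ideal T (P1 `&` T).
  apply: primeT; first exact: contraction_prime prP1.
  have [p P1p p0] := nonzero_elt (submodule0 hP1) P1n0.
  have [a [b [Ta Tb b0 ep]]] := proj2 hT p.
  have a0 : a != 0 by apply: contraNneq p0 => a0; rewrite ep a0 mul0r.
  apply: (@set1_neq _ _ a) => //; split=> //.
  have -> : a = b * p by rewrite ep mulrC divfK.
  by apply: (submoduleZ hP1) => //; apply: sTV.
have sub2 : P2 `&` T `<=` P1.
  have [id2 n21 _] := contraction_prime subV sTV prP2.
  have [_ _ /(_ _ id2) []] := max1.
  - by move=> x [/s12 P2x Tx].
  - by move=> -> x [].
  - by move=> e2; case: n21; rewrite e2; apply: subring1.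
have [s [t [Ts Tsz Tt Ttz est]]] := pT z.
have nP1s : ~ P1 s.
  move=> /s12 P2s; apply: nP21; rewrite -est.
  by apply: (submoduleD hP2) => //; apply: (submoduleZ hP2) => //; apply: sTV.
have [|//|//] := primeP1 s z (sTV _ Ts) (sP2V _ P2z).
by apply: sub2; split=> //; apply: (submoduleZ hP2) => //; apply: sTV.
Qed.

Lemma valuation_overring_dim0 : has_krull_dim (@setT L) 0.
Proof.
have subL : subring (@setT L) by apply/subringP.
split.
  exists (fun=> [set 0]); split=> // i _; exact: zero_ideal_prime.
case=> [//|m] P [primeP /(_ 0%N isT) [s01 ns10]].
have [[[P00 _ _] _] _ _] := primeP 0%N isT.
have [[hP1 _] nP11 _] := primeP 1%N isT.
have [|z P1z z0] := @nonzero_elt _ (P 1%N) (submodule0 hP1).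
  by move=> e1; apply: ns10; rewrite e1 => _ ->.
case: nP11; rewrite -(mulVf z0); exact: (submoduleZ hP1).
Qed.

Lemma valuation_overring_dim1 V : subring V -> T `<=` V ->
  (forall x, x != 0 -> V x \/ V x^-1) -> V <> setT -> has_krull_dim V 1.
Proof.
move=> subV sTV valV nVT.
have [x nVx] : exists x, ~ V x.
  apply: contrapT => nex; apply: nVT; rewrite eqEsubset; split=> // x _.
  by apply: contrapT => nVx; apply: nex; exists x.
have x0 : x != 0 by apply/eqP => x0; apply: nVx; rewrite x0; apply: subring0.
have Vxi : V x^-1 by have [] := valV x x0.
split.
  exists (fun i => if i == 0%N then [set 0] else nonunits V); split.
    by case=> [|i] _ /=; [exact: zero_ideal_prime|exact: nonunits_prime].
  case=> // _ /=; split=> [_ ->|s10].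
    by split; [exact: subring0|left].
  (* As [x] is outside [V], its inverse is a nonzero nonunit. *)
  suff : [set 0] x^-1 by move=> /eqP; rewrite invr_eq0 (negPf x0).
  by apply: s10; split=> //; right; rewrite invrK.
case=> [//|[//|m]] P [primeP chainP].
have [s01 n10] := chainP 0%N isT; have [s12 n21] := chainP 1%N isT.
have [[[P00 _ _] _] _ _] := primeP 0%N isT.
have P1n0 : P 1%N <> [set 0] by move=> e1; apply: n10; rewrite e1 => _ ->.
case: n21; have [pr1 pr2] := (primeP 1%N isT, primeP 2%N isT).
exact: overring_prime_subset subV sTV pr1 pr2 P1n0 s12.
Qed.

(** In [s + t * x = 1] one summand is outside [M]: either [x = (s * x) / s] or [x^-1 = t / (t * x)]
    is then a fraction over the complement of [M]. A nonzero element of [M] has no inverse in the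
    localization. *)
Lemma localization_valuation M : maximal_ideal T M -> M <> [set 0] ->
  let V := localization T (T `\` M) in
  [/\ overring T V, (forall x, x != 0 -> V x \/ V x^-1) & V <> setT].
Proof.
move=> maxM Mn0 V; have [[hM sMT] _ _] := maxM; split.
- apply: overring_localization => //.
  + by split; [exact: subring1|exact: maximal_ideal_not1 maxM].
  + by case=> _; apply; apply: submodule0 hM.
  + move=> x y [Tx nMx] [Ty nMy]; split; first exact: subringM.
    have [_ _ primeM] := maximal_ideal_prime subT maxM.
    by move=> /(primeM _ _ Tx Ty) [].
- move=> x x0; have [s [t [Ts Tsx Tt Ttx est]]] := pT x.
  have [Ms|nMs] := pselect (M s); last first.
    left; exists (s * x), s; split=> //; rewrite mulrC mulKf //.
    by apply/eqP => s0; apply: nMs; rewrite s0; apply: submodule0 hM.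
  have nMtx : ~ M (t * x).
    move=> Mtx; apply: (maximal_ideal_not1 maxM); rewrite -est.
    exact: (submoduleD hM).
  have tx0 : t * x != 0.
    by apply/eqP => tx0; apply: nMtx; rewrite tx0; apply: submodule0 hM.
  right; exists t, (t * x); split=> //.
  by move: tx0; rewrite mulf_eq0 negb_or => /andP[t0 _]; field; rewrite t0 x0.
- move=> eV; have [m Mm m0] := nonzero_elt (submodule0 hM) Mn0.
  have [a [s [Ta [Ts nMs] em]]] : V m^-1 by rewrite eV.
  have s0 : s != 0.
    by apply/eqP => s0; apply: nMs; rewrite s0; apply: submodule0 hM.
  apply: nMs.
  have <- : a * m = s by rewrite -[a](divfK s0) -em mulrAC mulVf // mul1r.
  exact: (submoduleZ hM).
Qed.

End PruferOverrings.

(** * Consequences of the Mori property *)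

Section MoriConductor.
Variables (L : fieldType) (R T : set L).
Hypotheses (subR : subring R) (subT : subring T) (sRT : R `<=` T).
Variable a : L.
Hypotheses (a0 : a != 0) (aA : colon R T a).
Hypothesis hcolon : colon R (colon R T) = T.
Hypothesis hMori : mori R.
Hypothesis pT : prufer T.

(* For invertible [J], the set [a J] is the divisorial ideal
   [(R : a^-1 (T : J) (R : T))] of [R]. *)
Lemma mori_invertible_acc (J : nat -> set L) :
  (forall n, ideal T (J n)) -> (forall n, invertible T (J n)) ->
  (forall n, J n `<=` J n.+1) -> exists n, J n = J n.+1.
Proof.
move=> idJ invJ monoJ.
pose F n := [set x | exists k c,
  [/\ colon T (J n) k, colon R T c & x = k * c / a]].
(* The colon is [a (J n)]: the condition says that [x / a] maps [(T : J n)] into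
   [(R : (R : T)) = T], and [J n] is reflexive. *)
have FE n x : colon R (F n) x <-> J n (x / a).
  have [hJ _] := idJ n; split=> [cx|Jx _ [k [c [ck cc ->]]]].
    apply: (invertible_reflexive hJ) => // k ck.
    rewrite -hcolon => c cc; have <- : x * (k * c / a) = x / a * k * c by ring.
    by apply: cx; exists k, c.
  have -> : x * (k * c / a) = c * (k * (x / a)) by ring.
  by apply: cc; apply: ck.
have [|||N eqN] := @mori_colon L R subR hMori F.
- move=> n x /FE Jx; rewrite -[x](divfK a0) mulrC; apply: aA.
  by have [_] := idJ n; apply.
- move=> n; have [z Jz z0] := invertible_nonzero (invJ n).
  by exists (z * a); [rewrite mulf_neq0|apply/FE; rewrite mulfK].
- by move=> n x /FE /monoJ Jx; apply/FE.
exists N; have eqF := eqN N.+1 (leqnSn N); rewrite eqEsubset.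
split=> [|x Jx]; first exact: monoJ.
rewrite -[x](mulfK a0); apply/FE; rewrite -eqF; apply/FE.
by rewrite mulfK.
Qed.

(** Among the finitely generated invertible ideals inside [I], a maximal one exists by the chain
    condition; adjoining any element of [I] stays in this class, so it is [I]. *)
Lemma ideal_fg_invertible I : ideal T I -> I <> [set 0] ->
  finitely_generated T I /\ invertible T I.
Proof.
move=> [hI sIT] /(nonzero_elt (submodule0 hI)) [z Iz z0].
pose P J := [/\ ideal T J, J `<=` I, finitely_generated T J & invertible T J].
have sub J : submodule T J -> J `<=` I -> ideal T J.
  by move=> hJ sJ; split=> // x /sJ /sIT.
have PJ0 : P !=set0.
  have sJ0 : [set t * z | t in T] `<=` I.
    by move=> _ [t Tt <-]; apply: (submoduleZ hI).
  exists [set t * z | t in T]; split=> //.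
    exact: sub (submodule_scale _ _) _.
    exact: finitely_generated_principal.
  exact: invertible_scale.
have [|J [[hJ _] sJI fgJ invJ] maxJ] := acc_maximal PJ0.
  by move=> C PC; apply: mori_invertible_acc => n; have [] := PC n.
suff -> : I = J by [].
rewrite eqEsubset; split=> // x Ix.
rewrite -(maxJ (add_generator T J x)).
    exact: add_generator_gen (submodule0 hJ).
  split.
  - apply: sub; first exact: submodule_add_generator.
    exact: add_generator_sub.
  - exact: add_generator_sub.
  - exact: finitely_generated_add_generator.
  - exact: invertible_add_generator.
exact: sub_add_generator.
Qed.

Lemma nonzero_ideal_maximal (P : set (set L)) : P !=set0 ->
  (forall J, P J -> ideal T J /\ J <> [set 0]) ->
  exists2 J, P J & forall J', P J' -> J `<=` J' -> J' = J.
Proof.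
move=> P0 Pid; apply: acc_maximal => // C PC.
apply: mori_invertible_acc => n; have [idC C0] := Pid _ (PC n) => //.
by have [] := ideal_fg_invertible idC C0.
Qed.

Lemma exists_maximal_ideal J : ideal T J -> J <> [set 0] -> J <> T ->
  exists2 M, maximal_ideal T M & J `<=` M.
Proof.
move=> idJ J0 nJT.
have [z Jz z0] : exists2 z, J z & z != 0.
  by apply: nonzero_elt => //; case: idJ => hJ _; apply: submodule0 hJ.
pose P M := [/\ ideal T M, J `<=` M & M <> T].
have [||M [idM sJM nMT] maxM] := @nonzero_ideal_maximal P.
- by exists J; split.
- by move=> M [idM /(_ z Jz) Mz _]; split=> //; apply: set1_neq Mz z0.
exists M => //; split=> // M' idM' sMM'.
have [->|nM'T] := pselect (M' = T); [by right|left].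
by apply: maxM => //; split=> //; apply: subset_trans sMM'.
Qed.

(** The ideals [(b T : r ^+ n)] ascend, hence agree at some [n] and [n.+1]. This agreement says that
    every multiplier of [K = b T + r ^+ n.+1 T] into [T] also sends [r ^+ n] into [T], so [r ^+ n]
    is in the reflexive ideal [K]. *)
Lemma power_mem_conductor r b : T r -> T b -> b != 0 ->
  exists n q t, [/\ T q, T t & r ^+ n = r ^+ n.+1 * q + b * t].
Proof.
move=> Tr Tb b0.
pose J n := [set z | T z /\ exists2 t, T t & z * r ^+ n = b * t].
have idJ n : ideal T (J n).
  split; last by move=> z [].
  split=> [|x y [Tx [s Ts es]] [Ty [t Tt et]]|c x Tc [Tx [s Ts es]]].
  - by split; [|exists 0]; rewrite ?mul0r ?mulr0 //; apply: subring0.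
  - split; first exact: subringD.
    by exists (s + t); [apply: subringD|rewrite mulrDl es et mulrDr].
  - split; first exact: subringM.
    by exists (c * s); [apply: subringM|rewrite -mulrA es mulrCA].
have Jb n : J n b by split=> //; exists (r ^+ n) => //; apply: subringX.
have [|n|n eqJ] := mori_invertible_acc idJ.
- by move=> n; have [] := ideal_fg_invertible (idJ n) (set1_neq (Jb n) b0).
- move=> z [Tz [t Tt et]]; split=> //; exists (t * r); first exact: subringM.
  by rewrite exprSr mulrA et mulrA.
pose B := [set t * b | t in T]; pose K := add_generator T B (r ^+ n.+1).
have hB : submodule T B by apply: submodule_scale.
have Bb : B b by exists 1; [apply: subring1|rewrite mul1r].
have hK : submodule T K by apply: submodule_add_generator.
have invK : invertible T K.
  by apply: invertible_add_generator => //; apply: invertible_scale.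
have [|_ [t [[s Ts <-] Tt er]]] := @invertible_reflexive _ _ _ hK invK (r ^+ n).
  move=> k ck.
  have Tkb : T (k * b) by apply: ck; apply: sub_add_generator.
  have Tkr : T (k * r ^+ n.+1).
    by apply: ck; apply: add_generator_gen => //; apply: submodule0 hB.
  have [_ [t Tt]] : J n (k * b).
    rewrite eqJ; split=> //; exists (k * r ^+ n.+1) => //; ring.
  by rewrite mulrAC [_ * b]mulrC [_ * k]mulrC => /(mulfI b0) ->.
by exists n, t, s; split=> //; rewrite er addrC [t * _]mulrC [s * _]mulrC.
Qed.

(* The ideals [{z in (R : T) | r^n z / b in R}] are divisorial, so they
   stabilise: for large [N], if [q in T] and [r^(N+k) q in R] then [r^N q in R]. *)
Lemma mori_almost_inverse r b : R r -> colon R T b -> b != 0 ->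
  exists N q t, [/\ R q, T t & r ^+ N * (r * q - 1) = b * t].
Proof.
move=> Rr bA b0; have Tr := sRT Rr.
have Rb : R b by rewrite -[b]mulr1; apply: bA (subring1 subT).
have Tb := sRT Rb.
pose F n := T `|` [set r ^+ n / b].
have [|||N1 stab] := @mori_colon L R subR hMori F.
- by move=> n x cx; rewrite -[x]mulr1; apply: cx; left; apply: subring1.
- move=> n; exists (b * b); first exact: mulf_neq0.
  move=> y [Ty|->]; first by rewrite -mulrA; apply: bA; apply: subringM.
  by rewrite mulrC mulrA divfK //; apply: subringM => //; apply: subringX.
- move=> n x cx y [Ty|->]; first by apply: cx; left.
  rewrite exprS -mulrA mulrCA; apply: subringM => //.
  by apply: cx; right.
have [n0 [q [t [Tq Tt eq0]]]] := power_mem_conductor Tr Tb b0.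
(* Iterating the relation shows that modulo [b T] a high power of [r] is a multiple of any higher
   one. *)
have step m k : (n0 <= m)%N -> exists q' t',
    [/\ T q', T t' & r ^+ m = r ^+ (m + k) * q' + b * t'].
  move=> /subnK <-; set d := (m - n0)%N; elim: k => [|k [q' [t' [Tq' Tt' ek]]]].
    exists 1, 0; rewrite addn0 mulr1 mulr0 addr0.
    by split=> //; [exact: subring1|exact: subring0].
  exists (q * q'), (t' + r ^+ (d + k) * t * q'); split.
  - exact: subringM.
  - apply: subringD => //; apply: subringM => //; apply: subringM => //.
    exact: subringX.
  - have -> : r ^+ (d + n0 + k.+1) = r ^+ (d + k) * r ^+ n0.+1.
      by rewrite -exprD !addnS addnAC.
    by rewrite ek addnAC [in LHS]exprD eq0; ring.
pose N := maxn N1 n0.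
have [q' [t' [Tq' Tt' eN]]] := step N N.+1 (leq_maxr _ _).
have Rbt : R (b * t') by apply: bA.
(* Stabilization is applied to [b * q']: it lies in the colon at index [N + N.+1], hence already at
   index [N]. *)
have Rq : R (r ^+ N * q').
  have : colon R (F (N + N.+1)%N) (b * q').
    move=> y [Ty|->]; first by rewrite -mulrA; apply: bA; apply: subringM.
    have -> : b * q' * (r ^+ (N + N.+1) / b) = r ^+ N - b * t'.
      by rewrite eN; field.
    by apply: subringB => //; apply: subringX.
  rewrite stab; last exact: leq_trans (leq_maxl N1 n0) (leq_addr _ _).
  rewrite -(stab N (leq_maxl _ _)) => cN.
  have -> : r ^+ N * q' = b * q' * (r ^+ N / b) by field.
  by apply: cN; right.
exists N, (r ^+ N * q'), (- t'); split=> //; first exact: subringN.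
have -> : b * - t' = r ^+ (N + N.+1) * q' - r ^+ N by rewrite eN; ring.
by rewrite exprD exprS; ring.
Qed.

(** This reduces the valuation overrings of [R] to those of [T], whose primes the Pruefer property
    controls. *)
Lemma valuation_overring_closure V : FC_domain R ->
  valuation_overring R V -> T `<=` V.
Proof.
move=> hFC [[subV sRV] valV] x Tx; apply: contrapT => nVx.
have x0 : x != 0 by apply/eqP => x0; apply: nVx; rewrite x0; apply: subring0.
set nu := nonunits V; have [[hnu _] nnu1 _] := nonunits_prime subV valV.
have nuy : nu x^-1.
  split; last by right; rewrite invrK.
  by have [] := valV x x0.
(* If [r * x ^+ m] is outside [V], its inverse is in [V]. The almost inverse gives
   [1 = q * r - a * t / r ^+ N]. The last term becomes a multiple of [x^-1] once [x ^+ (m * N).+1]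
   is absorbed by [a], so 1 would be a nonunit. *)
have bounded r : R r -> nu r -> forall m, V (r * x ^+ m).
  move=> Rr nur m; apply: contrapT => nVrx.
  have rx0 : r * x ^+ m != 0.
    by apply/eqP => rx0; apply: nVrx; rewrite rx0; apply: subring0.
  have Vrx : V (r * x ^+ m)^-1 by have [] := valV _ rx0.
  have r0 : r != 0 by move: rx0; rewrite mulf_eq0 negb_or => /andP[].
  have [N [q [t [Rq Tt eN]]]] := mori_almost_inverse Rr aA a0.
  have rN0 : r ^+ N != 0 by apply: expf_neq0.
  have xm0 : (x ^+ m) ^+ N != 0 by rewrite !expf_neq0.
  apply: nnu1.
  have -> : 1 = q * r -
      a * (t * x ^+ (m * N).+1) * (r * x ^+ m)^-1 ^+ N * x^-1.
    rewrite exprSr exprM exprVn exprMn.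
    have -> : a * (t * ((x ^+ m) ^+ N * x)) * (r ^+ N * (x ^+ m) ^+ N)^-1 / x =
        (a * t) / r ^+ N by field; rewrite ?rN0 ?xm0 ?x0 ?r0 ?expf_neq0.
    by rewrite -eN mulrAC mulfV // mul1r; ring.
  apply: (submoduleB subV hnu); apply: (submoduleZ hnu) => //; first exact: sRV.
  apply: subringM => //; last exact: subringX.
  by apply: sRV; apply: aA; apply: subringM => //; apply: subringX.
have [p [Rp px0 [j pj1]]] := FC_poly subR x hFC.
pose unit i := ~~ `[< nu p`_i >].
have uj : exists i, unit i by exists j; apply/asboolPn; rewrite pj1.
have ub i : unit i -> (i <= size p)%N.
  move=> /asboolPn nui; rewrite leqNgt; apply/negP => lti; apply: nui.
  by rewrite nth_default ?(ltnW lti) //; apply: submodule0 hnu.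
case: (ex_maxnP uj ub) => m /asboolPn num maxm.

have szm : (m < size p)%N.
  rewrite ltnNge; apply/negP => lem; apply: num.
  by rewrite nth_default //; apply: submodule0 hnu.
have Vp i : V p`_i by apply: sRV.
have xm0 : x ^+ m != 0 by apply: expf_neq0.
apply: num; have /eqP := congr1 (fun z => z / x ^+ m) px0.
rewrite horner_coef mul0r mulr_suml (bigD1 (Ordinal szm)) //= mulfK //.
rewrite addr_eq0 => /eqP ->; apply: (submoduleN subV hnu).
elim/big_rec: _ => [|i z neim nuz]; first exact: submodule0 hnu.
apply: (submoduleD hnu) => {z nuz} //.
have neim' : i <> m :> nat by move=> eim; move/eqP: neim; apply; apply: val_inj.
have [ltim|ltmi|//] := ltngtP i m.
  have -> : p`_i * x ^+ i / x ^+ m = p`_i * x^-1 ^+ (m - i).-1 * x^-1.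
    rewrite -[_ * x^-1 ^+ _ * _]mulrA -exprSr prednK ?subn_gt0 //.
    rewrite -[X in _ / x ^+ X](subnK (ltnW ltim)) exprD exprVn; field.
    by rewrite !expf_neq0.
  apply: (submoduleZ hnu) => //; apply: subringM => //; apply: subringX => //.
  by case: nuy.
have nupi : nu p`_i.
  apply: contrapT => nupi; have /maxm : unit i by apply/asboolPn.
  by rewrite leqNgt ltmi.
have -> : p`_i * x ^+ i / x ^+ m = p`_i * x ^+ (i - m).+1 * x^-1.
  have -> : x ^+ i = x ^+ (i - m) * x ^+ m by rewrite -exprD subnK // ltnW.
  by rewrite exprSr; field; rewrite x0 xm0.
by apply: (submoduleZ hnu) => //; apply: bounded.
Qed.

End MoriConductor.

(** * Finitely generated conductor *)

Section NoetherianBetween.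
Variables (L : fieldType) (R : set L).
Hypothesis subR : subring R.

(** For [J] a finitely generated submodule of [K], this says that [K / J] is a Noetherian
    [R]-module. *)
Definition noetherian_between (J K : set L) : Prop :=
  forall N, submodule R N -> J `<=` N -> N `<=` K -> finitely_generated R N.

(** The condition on [g] makes [(K + R g) / K] zero or simple. So either [N] lies in [K], or [N] is
    [N] intersected with [K] plus one generator [y], any element of [N] outside [K]. *)
Lemma noetherian_between_add_generator J0 K g :
  submodule R K -> J0 `<=` K ->
  (forall c, R c -> K (c * g) \/ exists2 s, R s & K ((1 - c * s) * g)) ->
  noetherian_between J0 K -> noetherian_between J0 (add_generator R K g).
Proof.
move=> hK sJ0K hg fgK N hN sJ0N sNK.
have hNK : submodule R (N `&` K).
  split=> [|x y [Nx Kx] [Ny Ky]|c x Rc [Nx Kx]].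
  - by split; [exact: submodule0 hN|exact: submodule0 hK].
  - by split; [exact: (submoduleD hN)|exact: (submoduleD hK)].
  - by split; [exact: (submoduleZ hN)|exact: (submoduleZ hK)].
have fgNK : finitely_generated R (N `&` K).
  by apply: fgK => // x Jx; split; [exact: sJ0N|exact: sJ0K].
have [sNK'|nsNK] := pselect (N `<=` K).
  suff -> : N = N `&` K by [].
  by rewrite eqEsubset; split=> x; [split=> //; apply: sNK'|case].
have [y /not_implyP [Ny nKy]] := (existsNP _).2 nsNK.
have [k [c [Kk Rc ey]]] := sNK y Ny.
have [Kcg|[s Rs Ks]] := hg c Rc.
  by case: nKy; rewrite ey; apply: (submoduleD hK).
suff -> : N = add_generator R (N `&` K) y.
  exact: finitely_generated_add_generator.
rewrite eqEsubset; split; last by apply: add_generator_sub => // x [].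
move=> x Nx; have [k' [c' [Kk' Rc' ex]]] := sNK x Nx.
exists (x - c' * s * y), (c' * s); split; [|exact: subringM|by rewrite subrK].
split.
  apply: (submoduleB subR hN) => //; apply: (submoduleZ hN) => //.
  exact: subringM.
have -> : x - c' * s * y = k' - c' * s * k + c' * ((1 - c * s) * g).
  by rewrite ex ey; ring.
apply: (submoduleD hK); last exact: (submoduleZ hK).
apply: (submoduleB subR hK) => //; apply: (submoduleZ hK) => //.
exact: subringM.
Qed.

Lemma noetherian_between_extend J0 K (l : seq L) :
  submodule R K -> J0 `<=` K -> noetherian_between J0 K ->
  (forall g, g \in l -> forall c, R c ->
     K (c * g) \/ exists2 s, R s & K ((1 - c * s) * g)) ->
  exists K', [/\ submodule R K', noetherian_between J0 K', K `<=` K' &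
                forall g, g \in l -> K' g].
Proof.
elim: l K => [|g l IH] K hK sJ0K nK hl; first by exists K; split.
have sK := @sub_add_generator L R subR K g.
have [||||K' [hK' nK' sKK' lK']] := IH (add_generator R K g).
- exact: submodule_add_generator.
- exact: subset_trans sK.
- apply: noetherian_between_add_generator => //.
  by apply: hl; rewrite mem_head.
- move=> g' lg' c Rc; have [|Kc|[s Rs Ks]] := hl g' _ c Rc.
  + by rewrite inE lg' orbT.
  + by left; apply: sK.
  + by right; exists s => //; apply: sK.
exists K'; split=> //; first exact: subset_trans sKK'.
move=> g'; rewrite inE => /orP[/eqP ->|/lK' //].
by apply: sKK'; apply: add_generator_gen => //; apply: submodule0 hK.
Qed.

End NoetherianBetween.

Lemma submodule_subring (L : fieldType) (R T M : set L) :
  R `<=` T -> submodule T M -> submodule R M.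
Proof. by move=> sRT [M0 MD MZ]; split=> // a x /sRT; apply: MZ. Qed.

Section FinitelyGeneratedConductor.
Variables (L : fieldType) (R T : set L).
Hypotheses (subR : subring R) (subT : subring T) (sRT : R `<=` T).
Variable a : L.
Hypotheses (a0 : a != 0) (aA : colon R T a).
Hypothesis hcolon : colon R (colon R T) = T.
Hypothesis hMori : mori R.
Hypothesis pT : prufer T.
Hypothesis fgA : finitely_generated R (colon R T).

Let inv := ideal_fg_invertible subR subT a0 aA hcolon hMori pT.

Lemma conductor_ideal : ideal T (colon R T) /\ colon R T `<=` R.
Proof.
have sAR : colon R T `<=` R.
  by move=> x Ax; rewrite -[x]mulr1; apply: Ax (subring1 subT).
split=> //; split; last by move=> x /sAR /sRT.
split=> [y Ty|x y Ax Ay z Tz|t x Tt Ax y Ty].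
- by rewrite mul0r; apply: subring0.
- by rewrite mulrDl; apply: subringD => //; [apply: Ax|apply: Ay].
- by rewrite mulrAC mulrC; apply: Ax; apply: subringM.
Qed.

(** Write [1] as a sum of products [x.1 * x.2] witnessing that [A = (R : T)] is invertible over [T].
    In [t = \sum (t * x.1) * x.2] the factors [t * x.1] lie in [A], so the products of the [x.2]
    with generators of [A] span [T] over [R]. *)
Lemma closure_generators : exists2 l : seq L,
  forall g, g \in l -> T g &
  forall M, submodule R M -> (forall g, g \in l -> M g) -> T `<=` M.
Proof.
have [[hA sAT] sAR] := conductor_ideal.
have [s sA s1] : invertible T (colon R T).
  by have [] := inv (conj hA sAT) (set1_neq aA a0).
have [n [g eA]] := fgA.
have gA i : colon R T (g i).
  rewrite eA; exists (fun j => (j == i)%:R).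
    by move=> j; case: (j == i); [exact: subring1|exact: subring0].
  rewrite (bigD1 i) //= eqxx mul1r big1 ?addr0 // => j /negPf ->.
  by rewrite mul0r.
exists [seq x.2 * g i | x <- s, i <- enum 'I_n].
  by move=> _ /allpairsP[[x i] /= [/sA[_ cx] _ ->]]; apply: cx; apply: gA.
move=> M hM lM t Tt; rewrite -[t]mulr1 -s1 mulr_sumr.
apply: (submodule_sum hM) => x xs; have [Ax cx] := sA x xs.
have : colon R T (t * x.1) by apply: (submoduleZ hA).
rewrite mulrA {1}eA => -[c Rc ->].
rewrite mulr_suml; apply: (submodule_sum_ord hM) => i.
rewrite -mulrA [g i * _]mulrC; apply: (submoduleZ hM) => //.
by apply: lM; apply/allpairsP; exists (x, i); rewrite mem_enum.
Qed.

(** An almost inverse [q] of [c] relative to [m * a], with [m] in [M], puts [c ^+ N * (c * q - 1)]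
    in [M]; the prime [M] does not contain [c ^+ N]. *)
Lemma maximal_ideal_residue_inverse M c : maximal_ideal T M -> M <> [set 0] ->
  R c -> ~ M c -> exists2 s, R s & M (1 - c * s).
Proof.
move=> maxM M0 Rc nMc; have [[hA sAT] sAR] := conductor_ideal.
have [[hM sMT] _ _] := maxM; have [_ nM1 primeM] := maximal_ideal_prime subT maxM.
have [m Mm m0] := nonzero_elt (submodule0 hM) M0.
have Tc := sRT Rc; have Tm := sMT _ Mm.
have mA : colon R T (m * a) by apply: (submoduleZ hA).
have [N [q [t [Rq Tt eN]]]] := mori_almost_inverse subR subT sRT a0 aA hcolon
  hMori pT Rc mA (mulf_neq0 m0 a0).
have Tq := sRT Rq.
exists q => //; rewrite -opprB; apply: (submoduleN subT hM).
have nMcN : ~ M (c ^+ N).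
  elim: (N) => [//|k IH]; rewrite exprS => /(primeM _ _ Tc) [|//|//].
  exact: subringX.
have [|||//|//] := primeM (c ^+ N) (c * q - 1).
- exact: subringX.
- by apply: subringB => //; [exact: subringM|exact: subring1].
rewrite eN -mulrA mulrC; apply: (submoduleZ hM) => //.
by apply: subringM => //; apply: sAT.
Qed.

Lemma noetherian_between_closure J0 : ideal T J0 -> J0 <> [set 0] ->
  finitely_generated R J0 -> noetherian_between R J0 T.
Proof.
move=> idJ0 J0n0 fgJ0; have [hJ0 sJ0T] := idJ0.
have [z J0z z0] := nonzero_elt (submodule0 hJ0) J0n0.
pose P J := [/\ ideal T J, J0 `<=` J & noetherian_between R J0 J].
have [||J [idJ sJ0J nJ] maxJ] :=
  @nonzero_ideal_maximal L R T subR subT a a0 aA hcolon hMori pT P.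
- exists J0; split=> // N hN sJN sNJ.
  by have -> : N = J0 by rewrite eqEsubset.
- by move=> J [idJ /(_ z J0z) Jz _]; split=> //; apply: set1_neq Jz z0.
have [<- //|nJT] := pselect (J = T).
have [hJ sJT] := idJ; have Jz := sJ0J _ J0z; have Jn0 := set1_neq Jz z0.
have [M maxM sJM] := exists_maximal_ideal subR subT a0 aA hcolon hMori pT
  idJ Jn0 nJT.
have Mz := sJM _ Jz; have Mn0 := set1_neq Mz z0.
have [idM _ _] := maxM; have [hM sMT] := idM.
have [_ [s sM s1]] := inv idM Mn0; have [_ invJ] := inv idJ Jn0.
(* Otherwise [(T : M) J] lies in [J], so [(T : M)] lies in [T] because [J] is invertible, and 1
   would be in [M]. This [w] spans a simple step above [J], which contradicts the maximality of
   [J]. *)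
have [w nJw Mw] : exists2 w, ~ J w & T w /\ forall m, M m -> J (w * m).
  apply: contrapT => nw; apply: (maximal_ideal_not1 maxM); rewrite -s1.
  apply: (submodule_sum hM) => x /sM [Mx cx]; rewrite mulrC.
  apply: (submoduleZ hM) => //; apply: (invertible_absorb subT invJ) => y Jy.
  apply: contrapT => nJxy; apply: nw; exists (x.2 * y) => //.
  split=> [|m Mm]; first by apply: cx; apply: sJM.
  by rewrite mulrAC; apply: (submoduleZ hJ) => //; apply: cx.
have [Tw wM] := Mw; have [l lT lspan] := closure_generators.
have hJR := submodule_subring sRT hJ.
have [|K [hK nK sJK lK]] :=
  noetherian_between_extend (l := [seq w * g | g <- l]) subR hJR sJ0J nJ.
  move=> _ /mapP[g lg ->] c Rc; have Tg := lT g lg.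
  have [Mc|nMc] := pselect (M c).
    left; have -> : c * (w * g) = g * (w * c) by ring.
    by apply: (submoduleZ hJ) => //; apply: wM.
  right; have [q Rq Mq] := maximal_ideal_residue_inverse maxM Mn0 Rc nMc.
  exists q => //; have -> : (1 - c * q) * (w * g) = g * (w * (1 - c * q)) by ring.
  by apply: (submoduleZ hJ) => //; apply: wM.
have TwK : T `<=` [set t | K (w * t)].
  apply: lspan => [|g lg].
    split=> [|x y Kx Ky|c x Rc Kx] /=.
    - by rewrite mulr0; apply: submodule0 hK.
    - by rewrite mulrDr; apply: (submoduleD hK).
    - by rewrite mulrCA; apply: (submoduleZ hK).
  by apply: lK; apply: map_f.
have sJw : add_generator T J w `<=` K.
  move=> _ [y [t [Jy Tt ->]]]; apply: (submoduleD hK); first exact: sJK.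
  by rewrite mulrC; apply: TwK.
have sJJw := @sub_add_generator L T subT J w.
case: nJw; rewrite -(maxJ (add_generator T J w)) //.
  by apply: add_generator_gen => //; apply: submodule0 hJ.
split; [exact: ideal_add_generator|exact: subset_trans sJJw|].
by move=> N hN sJN sNJ; apply: nK => //; apply: subset_trans sJw.
Qed.

Lemma finitely_generated_conductor_noetherian : noetherian R.
Proof.
move=> I [hI sIR]; have [[hA sAT] sAR] := conductor_ideal.
have [->|In0] := pselect (I = [set 0]).
  exact: finitely_generated_zero.
have [i Ii i0] := nonzero_elt (submodule0 hI) In0.
have Ti := sRT (sIR _ Ii).
(* The ideal [I] lies between [i (R : T)] and [T]. *)
apply: (@noetherian_between_closure [set i * x | x in colon R T]) => //.
- split; last by move=> _ [x /sAT Tx <-]; apply: subringM.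
  split=> [|_ _ [x Ax <-] [y Ay <-]|t _ Tt [x Ax <-]].
  + by exists 0; [exact: submodule0 hA|rewrite mulr0].
  + by exists (x + y); [exact: (submoduleD hA)|rewrite mulrDr].
  + by exists (t * x); [exact: (submoduleZ hA)|rewrite mulrCA].
- by apply: (@set1_neq _ _ (i * a)); [exists a|exact: mulf_neq0].
- exact: finitely_generated_scale.
- by move=> _ [x Ax <-]; rewrite mulrC; apply: (submoduleZ hI) => //; apply: sAR.
- exact: subset_trans sRT.
Qed.

End FinitelyGeneratedConductor.

(** * Assembling the structure of the complete integral closure *)

Theorem theorem3p6 (L : fieldType) (R : set L)
    (hR : domain_with_quotient_field R)
    (hMori : mori R) (hnf : ~ is_field R) (hFC : FC_domain R) :
  let Rbar := complete_integral_closure R in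
  [/\ dedekind Rbar, semilocal Rbar, colon R Rbar <> [set 0] &
      has_valuative_dim R 1] /\
  (finitely_generated R (colon R Rbar) -> noetherian R).
Proof.
move=> T; have subR : subring R by case: hR.
have [[subT sRT] [a a0 aA]] := complete_integral_closure_conductor hR hFC.
rewrite -/T in subT sRT aA.
have hcolon : colon R (colon R T) = T := colon_colon_closure hR hFC.
have hT : domain_with_quotient_field T := overring_quotient hR (conj subT sRT).
have cicT : completely_integrally_closed T :=
  cic_complete_integral_closure hR hFC.
have pT : prufer T := cic_prufer hT cicT subR hFC sRT.
have inv := ideal_fg_invertible subR subT a0 aA hcolon hMori pT.
have primeT P : prime_ideal T P -> P <> [set 0] -> maximal_ideal T P.
  by apply: prime_ideal_maximal => // I idI /(inv I idI) [].
have noethT : noetherian T.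
  move=> I idI; have [->|I0] := pselect (I = [set 0]).
    exact: finitely_generated_zero.
  by have [] := inv I idI I0.
(* Otherwise [T] is all of [L], and [a L], which is again [L], lies in [R], so [R] is a field. *)
have nfT : exists x, [/\ T x, x != 0 & ~ T x^-1].
  apply: contrapT => nx; apply: hnf.
  have allT x : T x.
    have [p [q [Tp Tq q0 ->]]] := proj2 hT x; apply: subringM => //.
    by apply: contrapT => nTq; apply: nx; exists q; split.
  by split=> // x Rx x0; rewrite -(mulVKf a0 x^-1); apply: aA; apply: allT.
split; last exact: finitely_generated_conductor_noetherian a0 aA hcolon hMori pT.
have ovT V : overring T V -> overring R V.
  by move=> [subV sTV]; split=> //; apply: subset_trans sTV.
split.
- split=> //; last exact: cic_integrally_closed.
  by have [x [Tx x0 nTx]] := nfT; case=> _ /(_ x Tx x0).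
- apply: FC_semilocal => // C ovC dC; apply: (FC_chain hFC); last by right.
  by move=> n; apply: ovT.
- exact: set1_neq aA a0.
split; last first.
  move=> V valV; have sTV := valuation_overring_closure subR subT sRT a0 aA
    hcolon hMori pT hFC valV.
  have [[subV sRV] vV] := valV; have [->|nV] := pselect (V = setT).
    by exists 0%N => //; apply: valuation_overring_dim0.
  by exists 1%N => //; apply: valuation_overring_dim1 sTV _ _.
have [x [Tx x0 nTx]] := nfT.
(* A maximal ideal over the nonunit [x] is nonzero; localizing there attains dimension 1. *)
have [|||M maxM sM] := exists_maximal_ideal subR subT a0 aA hcolon hMori pT
    (J := [set t * x | t in T]).
- split; first exact: submodule_scale.
  by move=> _ [t Tt <-]; apply: subringM.
- by apply: (@set1_neq _ _ x) => //; exists 1; [exact: subring1|rewrite mul1r].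
- move=> eT; have := subring1 subT; rewrite -{1}eT => -[t Tt e1].
  by apply: nTx; rewrite -[x^-1]mul1r -e1 mulfK.
have Mn0 : M <> [set 0].
  apply: (@set1_neq _ _ x) => //; apply: sM.
  by exists 1; [exact: subring1|rewrite mul1r].
have [ovV valV nV] := localization_valuation hT pT maxM Mn0.
exists (localization T (T `\` M)); first by split=> //; apply: ovT.
by have [subV sTV] := ovV; apply: valuation_overring_dim1 sTV _ _.
Qed.
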